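(* Let $m>1$ and $n>1$ be integers. Then the group $G_{mn}=\langle a,b;\ [a^m,b^n]=1\rangle$ is conjugacy separable.
   Context: $[x,y]=x^{-1}y^{-1}xy$. A group $G$ is conjugacy separable if for any two elements $f,g\in G$ that are not conjugate in $G$ there exists a homomorphism $\varphi$ of $G$ onto some finite group $X$ such that $f\varphi$ and $g\varphi$ are not conjugate in $X$. *)

(* Defs.v *)
(* The infinite group G_mn = < a, b ; [a^m, b^n] = 1 > is
   given by its presentation: elements are words over the letters
   a, b, a^-1, b^-1, and equality in G_mn is the congruence generated by
   free cancellation and insertion/deletion of the relator
   [a^m, b^n] = a^-m b^-n a^m b^n. *)
From mathcomp Require Import all_boot all_fingroup.
Set Implicit Arguments. Unset Strict Implicit. Unset Printing Implicit Defensive.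

(* A letter (g, e): g = false for a, true for b; e = true for the inverse. *)
Definition letter := (bool * bool)%type.
Definition word := seq letter.
Definition linv (l : letter) : letter := (l.1, ~~ l.2).
Definition winv (w : word) : word := rev (map linv w).

Definition la : letter := (false, false).
Definition lai : letter := (false, true).
Definition lb : letter := (true, false).
Definition lbi : letter := (true, true).

Definition relator (m n : nat) : word :=
  nseq m lai ++ nseq n lbi ++ nseq m la ++ nseq n lb.

Inductive Geq (m n : nat) : word -> word -> Prop :=
| Geq_refl u : Geq m n u u
| Geq_sym u v : Geq m n u v -> Geq m n v u
| Geq_trans u v w : Geq m n u v -> Geq m n v w -> Geq m n u w
| Geq_free u v l : Geq m n (u ++ l :: linv l :: v) (u ++ v)
| Geq_rel u v : Geq m n (u ++ relator m n ++ v) (u ++ v).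

Definition conjG (m n : nat) (f g : word) : Prop :=
  exists w : word, Geq m n (winv w ++ f ++ w) g.

Definition hom_onto (m n : nat) (X : finGroupType) (phi : word -> X) : Prop :=
  [/\ forall u v, Geq m n u v -> phi u = phi v,
      forall u v, phi (u ++ v) = (phi u * phi v)%g
    & forall x : X, exists w, phi w = x].

Definition conjugacy_separable_Gmn (m n : nat) : Prop :=
  forall f g : word, ~ conjG m n f g ->
    exists (X : finGroupType) (phi : word -> X),
      hom_onto m n phi /\ ~ (exists z : X, (phi f ^ z)%g = phi g).

(* Main.v *)
Require Import Defs.
From mathcomp Require Import all_boot all_fingroup.
From mathcomp Require Import all_order all_algebra.
From mathcomp Require Import zify ring.
From Stdlib Require Import Classical Setoid Morphisms.
Set Implicit Arguments. Unset Strict Implicit. Unset Printing Implicit Defensive.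
Import GRing.Theory.

(** G_mn is the tree product <a> *_{c = a^m} <c, d> *_{d = b^n} <b>, where
    <c, d> is free abelian of rank 2. Up to conjugacy, an element is either
    elliptic (a power of a, a power of b, or c^P d^Q), and elliptic elements
    are told apart by their images in the abelianization, or it is a
    cyclically reduced product of syllables a^i d^z and b^j c^z with
    0 < i < m and 0 < j < n.

    Let f be of the second kind, with L syllables, and let g have at most L
    syllables. The axis of f is a closed chain of L tori (cosets of <c, d>).
    Reducing exponents modulo a large number makes it a chain of finite tori,
    and a and b act on finitely many copies of them so that f fixes a base
    point. A Z_N-valued cocycle adds +1 when a syllable starts on the entry line
    of f into the next piece of the chain and +1 when it ends on the exit line,
    so the base point collects the weight 2L along f. If g is conjugate to f in
    the resulting finite permutation group, g has a fixed point with the same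
    weight; having at most L syllables, it must follow the chain of f all the
    way around, so its syllables are a rotation of those of f. *)

(** * Tokens, words and cyclic lists *)

(** The token (e, i, z) stands for the syllable x^i (y^k)^z, where x is the
    generator of index e (false for a, true for b), y is the other generator
    and k is the exponent of y in the relator. *)
Definition token := (bool * nat * int)%type.
Definition ty (t : token) : bool := t.1.1.
Definition ex (t : token) : nat := t.1.2.
Definition zz (t : token) : int := t.2.

Definition wpow (e : bool) (z : int) : word :=
  match z with Posz k => nseq k (e, false) | Negz k => nseq k.+1 (e, true) end.

Lemma linvK : involutive linv.
Proof. by case=> a b; rewrite /linv /= negbK. Qed.

Lemma winvK : involutive winv.
Proof.
by move=> w; rewrite /winv map_rev revK -map_comp map_id_in // => x _ /=; rewrite linvK.
Qed.

Lemma winv_cat u v : winv (u ++ v) = winv v ++ winv u.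
Proof. by rewrite /winv map_cat rev_cat. Qed.

Definition mono (e : bool) (s : seq token) := all (fun t => ty t == e) s.
(** Adjacent syllables of the same type can be merged when the torus element
    z between them is trivial. *)
Definition tred (t1 t2 : token) := (ty t1 == ty t2) ==> (zz t1 != 0%R).

Lemma cycle_last T (R : rel T) x p : path.cycle R (x :: p) = path R (last x p) (x :: p).
Proof. by rewrite /= rcons_path andbC. Qed.

Lemma not_path_split T (R : rel T) z s :
  ~~ path R z s -> exists s1 y s2, s = s1 ++ y :: s2 /\ ~~ R (last z s1) y.
Proof.
elim: s z => [|x s IH] z //=; case E: (R z x) => /= h.
  by have [s1 [y [s2 [-> hR]]]] := IH _ h; exists (x :: s1), y, s2.
by exists [::], x, s; rewrite /= E.
Qed.

Lemma not_cycle_split T (R : rel T) s :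
  ~~ path.cycle R s -> exists s1 y s2, s = s1 ++ y :: s2 /\ ~~ R (last y (s2 ++ s1)) y.
Proof.
case: s => [//|x p]; rewrite cycle_last => /(@not_path_split T) [s1 [y [s2 [E h]]]].
exists s1, y, s2; split => //; rewrite last_cat; move: h.
by case: s1 E => [|x1 s1] //= [-> ->].
Qed.

Lemma same_type_cycle_mono x s :
  path.cycle (fun t1 t2 => ty t1 == ty t2) (x :: s) -> mono (ty x) (x :: s).
Proof.
rewrite /= eqxx /=.
suff H z : path (fun t1 t2 => ty t1 == ty t2) z (rcons s x) -> mono (ty z) s by exact: H.
elim: s z => [//|y s IH] z /= /andP[/eqP -> /IH h]; by rewrite eqxx.
Qed.

(** * Word calculus in G_mn *)

Section Presentation.
Variables m n : nat.
Hypotheses (m1 : 1 < m) (n1 : 1 < n).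

Definition mu (e : bool) := if e then n else m.
Lemma mu_gt1 e : 1 < mu e. Proof. by case: e. Qed.

Local Notation "u =G v" := (Geq m n u v) (at level 70).

#[local] Instance Geq_equiv : Equivalence (Geq m n).
Proof.
by split=> [u|u v|u v w]; [exact: Geq_refl | exact: Geq_sym | exact: Geq_trans].
Qed.

#[local] Hint Resolve Geq_refl : core.

Lemma Geq_ctx x y u v : u =G v -> x ++ u ++ y =G x ++ v ++ y.
Proof.
elim=> {u v} [u|u v _ IH|u v w _ IH1 _ IH2|u v l|u v]; first exact: Geq_refl.
- exact: Geq_sym.
- exact: Geq_trans IH1 IH2.
- by have := Geq_free m n (x ++ u) (v ++ y) l; rewrite -!catA.
- by have := Geq_rel m n (x ++ u) (v ++ y); rewrite -!catA.
Qed.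

#[local] Instance cat_Geq : Proper (Geq m n ==> Geq m n ==> Geq m n) cat.
Proof.
move=> u u' Hu v v' Hv; transitivity (u' ++ v).
  by have := Geq_ctx [::] v Hu.
by have := Geq_ctx u' [::] Hv; rewrite !cats0.
Qed.

#[local] Instance cons_Geq (l : letter) : Proper (Geq m n ==> Geq m n) (cons l).
Proof. by move=> u v h; rewrite -(cat1s l u) -(cat1s l v) h. Qed.

Lemma winv_mulr w : w ++ winv w =G [::].
Proof.
elim/last_ind: w => [|w l IH]; first by [].
rewrite -cats1 winv_cat -catA /=.
by transitivity (w ++ winv w) => //; exact: Geq_free.
Qed.

Lemma winv_mull w : winv w ++ w =G [::].
Proof. by have := winv_mulr (winv w); rewrite winvK. Qed.

Definition wcommute u v := u ++ v =G v ++ u.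

Lemma wcommute_catCA u v w : wcommute u v -> u ++ v ++ w =G v ++ u ++ w.
Proof. by rewrite /wcommute => h; rewrite catA h -catA. Qed.

Lemma wcommute_sym u v : wcommute u v -> wcommute v u.
Proof. by exact: Geq_sym. Qed.

Lemma wcommute_catr u v w : wcommute u v -> wcommute u w -> wcommute u (v ++ w).
Proof. by rewrite /wcommute => h1 h2; rewrite catA h1 -catA h2 catA. Qed.

Lemma wcommute_invr u v : wcommute u v -> wcommute u (winv v).
Proof.
rewrite /wcommute => h.
have -> : u ++ winv v =G (winv v ++ v) ++ u ++ winv v by rewrite winv_mull.
by rewrite -catA (catA v) -h -(catA u) winv_mulr cats0.
Qed.

Lemma wcommute_nseqr u k l : wcommute u [:: l] -> wcommute u (nseq k l).
Proof.
move=> h; elim: k => [|k IH]; first by rewrite /wcommute cats0.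
exact: (wcommute_catr h IH).
Qed.

Lemma winv_nseq k e b : winv (nseq k (e, b)) = nseq k (e, ~~ b).
Proof. by rewrite /winv map_nseq rev_nseq. Qed.

Lemma wpow_NegzE e k : wpow e (Negz k) = winv (wpow e (Posz k.+1)).
Proof. by rewrite /wpow winv_nseq. Qed.

Lemma wcommute_wpow_gen e b z : wcommute [:: (e, b)] (wpow e z).
Proof.
have hpos k : wcommute [:: (e, false)] (nseq k (e, false)).
  exact: wcommute_nseqr.
have hz : wcommute [:: (e, false)] (wpow e z).
  by case: z => k; rewrite ?wpow_NegzE //; [exact: hpos | apply/wcommute_invr/hpos].
case: b => //; apply: wcommute_sym.
by have := wcommute_invr (wcommute_sym hz).
Qed.

Lemma wcommute_nseq_wpow e i z : wcommute (nseq i (e, false)) (wpow e z).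
Proof. exact/wcommute_sym/wcommute_nseqr/wcommute_sym/wcommute_wpow_gen. Qed.

Lemma wpowS e z : wpow e (z + 1)%R =G wpow e z ++ [:: (e, false)].
Proof.
transitivity ([:: (e, false)] ++ wpow e z); last exact: wcommute_wpow_gen.
case: z => k; first by rewrite (_ : (Posz k + 1)%R = Posz k.+1) //; lia.
have -> : wpow e (Negz k) = (e, true) :: wpow e (Negz k + 1)%R.
  by case: k => [|k] //; rewrite (_ : (Negz k.+1 + 1)%R = Negz k) //; lia.
symmetry; exact: (Geq_free m n [::] _ (e, false)).
Qed.

Lemma wpowB1 e z : wpow e (z - 1)%R =G wpow e z ++ [:: (e, true)].
Proof.
have h := wpowS e (z - 1)%R; rewrite subrK in h; rewrite h -catA.
by rewrite (winv_mulr [:: (e, false)]) cats0.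
Qed.

Lemma wpowD e z1 z2 : wpow e (z1 + z2)%R =G wpow e z1 ++ wpow e z2.
Proof.
elim/int_ind: z2 => [|k IH|k IH]; first by rewrite addr0 cats0.
  have -> : (z1 + k.+1%:Z)%R = (z1 + k%:Z + 1)%R by lia.
  have -> : k.+1%:Z%R = (k%:Z + 1)%R by lia.
  by rewrite !wpowS IH catA.
have -> : (z1 - k.+1%:Z)%R = (z1 - k%:Z - 1)%R by lia.
have -> : (- k.+1%:Z)%R = (- k%:Z - 1)%R by lia.
by rewrite !wpowB1 IH catA.
Qed.

(** These are c^z for [false] and d^z for [true], the elements that span the torus group <c, d>. *)
Definition cw e (z : int) := wpow e ((mu e : int) * z)%R.

Lemma cw0 e : cw e 0 = [::].
Proof. by rewrite /cw mulr0. Qed.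

Lemma cw1 e : cw e 1 = nseq (mu e) (e, false).
Proof. by rewrite /cw mulr1. Qed.

Lemma cwD e z1 z2 : cw e (z1 + z2)%R =G cw e z1 ++ cw e z2.
Proof. by rewrite /cw mulrDr wpowD. Qed.

Lemma wcommute_relator : wcommute (nseq m la) (nseq n lb).
Proof.
have h : nseq m lai ++ nseq n lbi ++ nseq m la ++ nseq n lb =G [::].
  by have := Geq_rel m n [::] [::]; rewrite cats0.
rewrite /wcommute; have -> : nseq m la ++ nseq n lb =G
    (nseq n lb ++ nseq m la) ++ nseq m lai ++ nseq n lbi ++ nseq m la ++ nseq n lb.
  have e : winv (nseq n lb ++ nseq m la) = nseq m lai ++ nseq n lbi.
    by rewrite winv_cat !winv_nseq.
  by rewrite (catA (nseq m lai)) -e catA winv_mulr.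
by rewrite h cats0.
Qed.

(** The relator gives the exponents 1 and 1; induction gives nonnegative ones, and commutation
    passes to inverses. *)
Lemma wcommute_cw_cross z1 z2 : wcommute (cw false z1) (cw true z2).
Proof.
have pos k1 k2 : wcommute (wpow false (m * k1)%N) (wpow true (n * k2)%N).
  have nseqM k j (l : letter) : nseq (j * k.+1) l = nseq j l ++ nseq (j * k) l.
    by rewrite mulnS nseqD.
  have h1 k : wcommute (nseq m la) (nseq (n * k) lb).
    elim: k => [|k IH]; first by rewrite muln0 /wcommute cats0.
    by rewrite nseqM; apply: wcommute_catr => //; exact: wcommute_relator.
  apply: wcommute_sym; rewrite /=.
  elim: k1 => [|k IH]; first by rewrite muln0 /wcommute cats0.
  by rewrite nseqM; apply: wcommute_catr => //; exact/wcommute_sym/h1.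
have cwE e z : exists k : nat, cw e z = wpow e (mu e * k)%N \/
    cw e z = winv (wpow e (mu e * k)%N).
  rewrite /cw; case: z => k; first by exists k; left; rewrite PoszM.
  exists k.+1; right; have := mu_gt1 e; case E: (mu e * k.+1) => [|j] ?; first lia.
  by rewrite -wpow_NegzE; congr wpow; lia.
have [k1 H1] := cwE false z1; have [k2 H2] := cwE true z2.
have {}H2 : wcommute (wpow false (m * k1)%N) (cw true z2).
  by case: H2 => ->; [exact: pos | exact/wcommute_invr/pos].
apply: wcommute_sym; case: H1 => ->; first exact: wcommute_sym.
exact/wcommute_invr/wcommute_sym.
Qed.

Lemma wcommute_cw e1 e2 z1 z2 : wcommute (cw e1 z1) (cw e2 z2).
Proof.
case: (eqVneq e1 e2) => [->|].
  by rewrite /wcommute -!cwD addrC.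
case: e1; case: e2 => // _; first exact/wcommute_sym/wcommute_cw_cross.
exact: wcommute_cw_cross.
Qed.

Lemma wcommute_gen_cw e i z : wcommute (nseq i (e, false)) (cw e z).
Proof. exact: wcommute_nseq_wpow. Qed.

Lemma conjG_equiv : Equivalence (conjG m n).
Proof.
split=> [u|u v [w h]|u v x [w1 h1] [w2 h2]].
- by exists [::]; rewrite cats0.
- exists (winv w); rewrite winvK -h -catA.
  by rewrite -!catA winv_mulr cats0 catA winv_mulr.
- by exists (w1 ++ w2); rewrite winv_cat -h2 -h1 -!catA.
Qed.
#[local] Existing Instance conjG_equiv.

Lemma conjG_refl u : conjG m n u u.
Proof. reflexivity. Qed.
#[local] Hint Resolve conjG_refl : core.

Lemma conjG_Geq u v : u =G v -> conjG m n u v.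
Proof. by move=> h; exists [::]; rewrite cats0. Qed.

#[local] Instance conjG_proper : Proper (Geq m n ==> Geq m n ==> iff) (conjG m n).
Proof.
move=> u u' hu v v' hv; split=> [] [w h]; exists w; first by rewrite -hu -hv.
by rewrite hu hv.
Qed.

Lemma conjG_catC u v : conjG m n (u ++ v) (v ++ u).
Proof. by exists u; rewrite -!catA catA winv_mull. Qed.

(** * Syllable words and their normal forms up to conjugacy *)

Definition tokw (t : token) : word := nseq (ex t) (ty t, false) ++ cw (~~ ty t) (zz t).
Definition tw (s : seq token) : word := flatten (map tokw s).
Definition elt e P Q s := cw e P ++ cw (~~ e) Q ++ tw s.
Definition tvalid (t : token) := 0 < ex t < mu (ty t).

Lemma tw_cat s1 s2 : tw (s1 ++ s2) = tw s1 ++ tw s2.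
Proof. by rewrite /tw map_cat flatten_cat. Qed.

Lemma tw_cons t s : tw (t :: s) = tokw t ++ tw s.
Proof. by []. Qed.

Lemma elt_swap e P Q s : elt e P Q s =G elt (~~ e) Q P s.
Proof. by rewrite /elt negbK !catA (wcommute_cw e (~~ e)). Qed.

(** A new letter on the left commutes with the torus power of its own type; the other torus power
    becomes the torus part of the new syllable. *)
Lemma word_elt w : exists P Q s, w =G elt false P Q s /\ all tvalid s.
Proof.
elim: w => [|[e b] w [P [Q [s [h vs]]]]]; first by exists 0%R, 0%R, [::]; rewrite /elt !cw0.
suff H e' (P' Q' : int) : exists P1 s1,
    (e', b) :: elt e' P' Q' s =G elt e' P1 0 s1 /\ all tvalid s1.
  have hw : (e, b) :: w =G (e, b) :: elt false P Q s by rewrite h.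
  case: e hw => hw.
    have [P1 [s1 [h1 v1]]] := H true Q P; exists 0%R, P1, s1; split => //.
    by rewrite hw (elt_swap false P) (elt_swap false 0%R) h1.
  by have [P1 [s1 [h1 v1]]] := H false P Q; exists P1, 0%R, s1; rewrite hw.
have mu1 := mu_gt1 e'.
case: b.
  (* Syllable exponents must be positive, so x^-1 is written as x^(-mu) x^(mu - 1). *)
  exists (P' - 1)%R, ((e', (mu e').-1, Q') :: s); split; last first.
    by rewrite /= vs andbT /tvalid /ex /ty /=; lia.
  rewrite /elt cw0 /= tw_cons /tokw /= /ex /ty /zz /= cwD.
  have c : wcommute [:: (e', true)] (cw e' P') by exact: wcommute_wpow_gen.
  have -> : cw e' (-1) =G [:: (e', true)] ++ winv (nseq (mu e').-1 (e', false)).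
    by rewrite winv_nseq /cw mulrN1 /wpow; case E: (mu e') mu1 => [|[|k]].
  rewrite -!catA (catA (winv _)) winv_mull /=.
  exact: (wcommute_catCA _ c).
exists P', ((e', 1, Q') :: s); split; last by rewrite /= vs andbT /tvalid /=.
rewrite /elt cw0 /= tw_cons /tokw /= /ex /ty /zz /=.
have c : wcommute [:: (e', false)] (cw e' P') by exact: wcommute_wpow_gen.
exact: (wcommute_catCA _ c).
Qed.

Lemma elt_prefix e P Q P1 Q1 s :
  cw e P ++ cw (~~ e) Q ++ elt e P1 Q1 s =G elt e (P + P1)%R (Q + Q1)%R s.
Proof.
rewrite /elt !cwD -!catA.
by rewrite (wcommute_catCA _ (wcommute_cw (~~ e) e Q P1)).
Qed.

Lemma wcommute_tokw t P : wcommute (tokw t) (cw (ty t) P).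
Proof.
apply: wcommute_sym; apply: wcommute_catr; last exact: wcommute_cw.
exact/wcommute_sym/wcommute_gen_cw.
Qed.

Lemma wcommute_tw_mono e P s : mono e s -> wcommute (tw s) (cw e P).
Proof.
move=> h; apply: wcommute_sym; elim: s h => [|t s IH] /=.
  by rewrite /wcommute cats0.
case/andP=> /eqP E h; apply: wcommute_catr; last exact: IH.
by rewrite -E; exact/wcommute_sym/wcommute_tokw.
Qed.

Lemma tw_rcons s t : tw (rcons s t) = tw s ++ tokw t.
Proof. by rewrite -cats1 tw_cat /= /tw /= cats0. Qed.

Lemma tokw_cat_cw t P : tokw t ++ cw (~~ ty t) P =G tokw (t.1, (zz t + P)%R).
Proof. by rewrite /tokw -catA -cwD. Qed.

(** The power moves left past syllables of type [e], with which it commutes, into the torus part of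
    the last syllable of the other type. *)
Lemma absorb_cw e P s : has (fun t => ty t == ~~ e) s ->
  exists s', tw s ++ cw e P =G tw s' /\ map fst s' = map fst s.
Proof.
elim/last_ind: s => [//|s t IH]; rewrite has_rcons /=.
case: (eqVneq (ty t) (~~ e)) => [E _|E /= /IH [s' [h1 h2]]].
  exists (rcons s (t.1, zz t + P)%R); split; last by rewrite !map_rcons.
  by rewrite !tw_rcons -catA -tokw_cat_cw E negbK.
have {}E : ty t = e by move: E; case: (ty t); case: (e).
exists (rcons s' t); rewrite !map_rcons h2; split => //.
by rewrite !tw_rcons -catA -{1}E (wcommute_tokw t P) E catA h1.
Qed.

Lemma all_tvalid_fst s s' : map fst s' = map fst s -> all tvalid s' = all tvalid s.
Proof.
elim: s s' => [|t s IH] [|t' s'] //= [h /IH ->].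
by rewrite /tvalid /ex /ty h.
Qed.

Lemma mono_fst e s s' : map fst s' = map fst s -> mono e s' = mono e s.
Proof.
by elim: s s' => [|t s IH] [|t' s'] //= [h /IH ->]; rewrite /ty h.
Qed.

Lemma size_fst (s s' : seq token) : map fst s' = map fst s -> size s' = size s.
Proof. by move/(congr1 size); rewrite !size_map. Qed.

Lemma has_not_mono e s : ~~ mono e s = has (fun t => ty t == ~~ e) s.
Proof.
by rewrite /mono -has_predC; apply: eq_has => t /=; case: (ty t); case: (e).
Qed.

(** Conjugation carries the torus prefix to the right end, where syllables absorb it. If both types
    occur, both powers disappear; if only one does, the power of that type survives. *)
Lemma elt_absorb e P Q s : s != [::] -> exists e' P' s',
  [/\ conjG m n (elt e P Q s) (elt e' P' 0 s'), map fst s' = map fst s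
     & mono e' s' \/ P' = 0%R].
Proof.
move=> s0.
have Hmono e1 P1 Q1 : mono e1 s -> exists s',
    conjG m n (elt e1 P1 Q1 s) (elt e1 P1 0 s') /\ map fst s' = map fst s.
  move=> h; have [|s' [h1 h2]] := @absorb_cw (~~ e1) Q1 s.
    rewrite negbK; case: (s) s0 h => [//|t r] _ /=.
    by case/andP=> ->.
  exists s'; split=> //; rewrite /elt cw0 /= -h1.
  by rewrite (wcommute_catCA _ (wcommute_cw e1 (~~ e1) P1 Q1)) conjG_catC -catA.
have [h|h] := boolP (mono e s).
  have [s' [h1 h2]] := Hmono e P Q h; exists e, P, s'; split => //.
  by left; rewrite (mono_fst _ h2).
have [h'|h'] := boolP (mono (~~ e) s).
  have [s' [h1 h2]] := Hmono (~~ e) Q P h'; exists (~~ e), Q, s'; split => //.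
    by rewrite elt_swap.
  by left; rewrite (mono_fst _ h2).
have [|s1 [h1 h2]] := @absorb_cw e P s; first by rewrite -has_not_mono.
have [|s2 [h3 h4]] := @absorb_cw (~~ e) Q s1.
  by rewrite -has_not_mono (mono_fst _ h2).
exists e, 0%R, s2; split; [|by rewrite h4|by right].
by rewrite /elt !cw0 /= -h3 -h1 catA conjG_catC -!catA.
Qed.

(** The syllables moved around must commute with the torus prefix, hence the alternative in the
    hypothesis. *)
Lemma elt_rot e P s1 s2 : mono e (s1 ++ s2) \/ P = 0%R ->
  conjG m n (elt e P 0 (s1 ++ s2)) (elt e P 0 (s2 ++ s1)).
Proof.
rewrite /elt cw0 /= !tw_cat => h.
suff: wcommute (tw s1) (cw e P).
  by move=> c; rewrite (wcommute_catCA _ (wcommute_sym c)) conjG_catC -!catA.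
case: h => [|->]; last by rewrite cw0 /wcommute cats0.
by rewrite /mono all_cat => /andP[h _]; exact: wcommute_tw_mono.
Qed.

(** A torus power x^(mu e * P) commutes with all syllables of type e, but it can
    be absorbed by a syllable of the other type. So P is an invariant only of a
    word with syllables of one type; any other word is cut at a change of
    type. *)
Definition nform e (P : int) s :=
  [/\ all tvalid s, s <> [::], ty (head (e, 0, 0%R) s) = e
    & mono e s \/ (P = 0%R /\ ty (last (e, 0, 0%R) s) <> e)].
Lemma elt_nform_rot e P s : s != [::] -> all tvalid s -> mono e s \/ P = 0%R ->
  path.cycle tred s ->
  exists e' s', [/\ conjG m n (elt e P 0 s) (elt e' P 0 s'), nform e' P s',
    size s' = size s & path.cycle tred s'].
Proof.
move=> s0 vs h cyc.
have [hm|hm] := boolP (mono e s).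
  exists e, s; split => //; split => //; [exact/eqP | | by left].
  by case: (s) s0 hm => //= t r _ /andP[/eqP].
have {h}P0 : P = 0%R by case: h => // h; rewrite h in hm.
case: s s0 vs cyc hm => [//|x s] _ vs cyc hm.
have hn : ~~ mono (ty x) (x :: s) \/ mono (ty x) (x :: s) by case: mono; auto.
have elt0 e1 e2 s1 : elt e1 0 0 s1 = elt e2 0 0 s1 by rewrite /elt !cw0.
case: hn => hn; last first.
  exists (ty x), (x :: s); rewrite P0; split => //.
    by rewrite (elt0 e (ty x)).
  by split => //; left.
have hc : ~~ path.cycle (fun t1 t2 => ty t1 == ty t2) (x :: s).
  by apply: contra hn; exact: same_type_cycle_mono.
have [s1 [y [s2 [E hy]]]] := not_cycle_split hc.
exists (ty y), (y :: s2 ++ s1); rewrite E P0; split.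
- by rewrite (elt0 _ e) -cat_cons; apply: elt_rot; right.
- split => //; last by right; split => //; apply/eqP.
  by move: vs; rewrite E -cat_cons !all_cat andbC.
- by rewrite -cat_cons !size_cat addnC.
- by rewrite -cat_cons -rot_size_cat rot_cycle -E.
Qed.

(** If i + j reaches [mu e], one torus power splits off; at equality the syllable vanishes and its
    torus part joins the prefix. *)
Lemma merge_tokens e i j z s : 0 < i < mu e -> 0 < j < mu e -> all tvalid s ->
  exists P Q s', [/\ tw [:: (e, i, 0%R), (e, j, z) & s] =G elt e P Q s',
    all tvalid s' & size s' <= (size s).+1].
Proof.
move=> hi hj vs.
have Ew : tw [:: (e, i, 0%R), (e, j, z) & s]
    = nseq (i + j) (e, false) ++ cw (~~ e) z ++ tw s.
  by rewrite !tw_cons /tokw /= /ex /ty /zz /= cw0 cats0 nseqD -!catA.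
have [lt|] := boolP (i + j < mu e).
  exists 0%R, 0%R, ((e, i + j, z) :: s); rewrite Ew /elt !cw0 tw_cons -catA; split => //=.
  by rewrite vs andbT /tvalid /ex /ty /=; lia.
rewrite -leqNgt leq_eqVlt => /orP[/eqP eq|lt].
  by exists 1%R, z, s; rewrite Ew -eq /elt cw1.
exists 1%R, 0%R, ((e, i + j - mu e, z) :: s); split => //=.
  rewrite Ew /elt cw0 /= cw1 tw_cons /tokw /= !catA -nseqD.
  by rewrite /ex /= subnKC // ltnW.
by rewrite vs andbT /tvalid /ex /ty /=; lia.
Qed.

(** Powers of a generator and torus elements both fit this shape, whose exponents are read off in
    the abelianization. *)
Definition eform w :=
  exists z1 z2, conjG m n w (wpow false z1 ++ wpow true z2).
Definition gform w L := (exists e P Q, L = 0 /\ conjG m n w (elt e P Q [::])) \/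
  (exists e P s, [/\ L = size s, conjG m n w (elt e P 0 s) & nform e P s]).
(** A single syllable is its own cyclic neighbour, so [tred] also excludes pure powers of a
    generator. *)
Definition hform w L := exists e P s,
  [/\ L = size s, conjG m n w (elt e P 0 s), nform e P s & path.cycle tred s].

Lemma hform_conj u w L : conjG m n u w -> hform w L -> hform u L.
Proof. by move=> c [e [P [s [? c' ? ?]]]]; exists e, P, s; split => //; rewrite c. Qed.

Lemma gform_conj u w L : conjG m n u w -> gform w L -> gform u L.
Proof.
move=> c [[e [P [Q [? c']]]]|[e [P [s [? c' ?]]]]]; [left|right].
  by exists e, P, Q; split => //; rewrite c.
by exists e, P, s; split => //; rewrite c.
Qed.

Lemma eform_conj u w : conjG m n u w -> eform w -> eform u.
Proof. by move=> c [z1 [z2 c']]; exists z1, z2; rewrite c. Qed.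

(** Induction on the number of syllables: where cyclic reduction fails, the two neighbours are
    rotated to the front and merged, which shortens the word. *)
Lemma classify_elt k e P Q s : size s <= k -> all tvalid s ->
  (exists L, hform (elt e P Q s) L) \/
  (eform (elt e P Q s) /\ exists2 L, L <= 1 & gform (elt e P Q s) L).
Proof.
elim: k e P Q s => [|k IH] e P Q s szs vs.
all: case: (eqVneq s [::]) => [->|s0]; [right; split |].
all: try by (exists 0 => //; left; exists e, P, Q).
1, 3: by case: e; [exists (m%:Z * Q)%R, (n%:Z * P)%R | exists (m%:Z * P)%R, (n%:Z * Q)%R];
  rewrite ?(elt_swap true) /elt /= cats0.
  by case: s szs s0 {vs}.
have [e1 [P1 [s1 [c1 f1 h1]]]] := elt_absorb e P Q s0.
have s10 : s1 != [::] by rewrite -size_eq0 (size_fst f1) size_eq0.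
have v1 : all tvalid s1 by rewrite (all_tvalid_fst f1).
rewrite -(size_fst f1) in szs.
have [cyc|ncyc] := boolP (path.cycle tred s1).
  have [e2 [s2 [c2 n2 _ cyc2]]] := elt_nform_rot s10 v1 h1 cyc.
  by left; exists (size s2); exists e2, P1, s2; split => //; rewrite c1.
have [r1 [y [r2 [E hy]]]] := not_cycle_split ncyc.
have c2 : conjG m n (elt e P Q s) (elt e1 P1 0 (y :: r2 ++ r1)).
  by rewrite c1 E -cat_cons; apply: elt_rot; rewrite -E.
have h2 : mono e1 (y :: r2 ++ r1) \/ P1 = 0%R.
  by case: h1 => h; [left | right] => //; move: h; rewrite E -cat_cons /mono !all_cat andbC.
have v2 : all tvalid (y :: r2 ++ r1) by move: v1; rewrite E -cat_cons !all_cat andbC.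
have sz2 : size (r2 ++ r1) <= k.
  by move: szs; rewrite E size_cat /= addnS size_cat addnC.
case: (lastP (r2 ++ r1)) hy c2 h2 v2 sz2 => [|r x] hy c2 h2 v2 sz2.
  (* A lone syllable that fails [tred] against itself has trivial torus part, so the element is a
     power of a generator. *)
  have {}hy : zz y = 0%R by apply/eqP; move: hy; rewrite /tred /= eqxx /= negbK.
  have c3 : conjG m n (elt e P Q s) (elt (ty y) P1 0 [:: y]).
    case: h2 => h2; last by rewrite c2 h2 /elt !cw0.
    by move: h2 c2; rewrite /mono /= andbT => /eqP ->.
  right; split.
    apply: (eform_conj c3); pose z := ((mu (ty y))%:Z * P1 + (ex y)%:Z)%R.
    have c4 : elt (ty y) P1 0 [:: y] =G wpow (ty y) z.
      by rewrite /elt cw0 /tw /= cats0 /tokw hy cw0 cats0 wpowD.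
    move: c4; case: (ty y) => c4; [exists 0%R, z | exists z, 0%R]; rewrite c4 //=.
    by rewrite cats0.
  exists 1 => //; apply: (gform_conj c3); right; exists (ty y), P1, [:: y]; split => //.
  by split => //; left; rewrite /mono /= eqxx.
rewrite last_rcons in hy.
have {}hy : ty x = ty y /\ zz x = 0%R.
  by move: hy; rewrite /tred negb_imply negbK => /andP[/eqP -> /eqP].
have c3 : conjG m n (elt e P Q s) (elt e1 P1 0 [:: x, y & r]).
  rewrite c2 -cats1 -cat_cons -[x :: y :: r]cat1s; apply: elt_rot.
  by rewrite cat_cons cats1.
have [vy vx vr] : [/\ tvalid y, tvalid x & all tvalid r].
  by move: v2; rewrite /= all_rcons => /and3P[].
have [Hty Hz] := hy.
have {}c3 : conjG m n (elt e P Q s) (elt (ty y) P1 0 [:: x, y & r]).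
  case: h2 => h2; last by rewrite c3 h2 /elt !cw0.
  by move: h2 c3; rewrite /mono /= => /andP[/eqP -> _].
have hx : 0 < ex x < mu (ty y) by rewrite -Hty.
have [P' [Q' [s' [c4 v4 sz4]]]] := merge_tokens (zz y) hx vy vr.
have {}c4 : conjG m n (elt e P Q s) (elt (ty y) (P1 + P')%R (0 + Q')%R s').
  have Ex : x = (ty y, ex x, 0%R) by rewrite -Hty -Hz; case: (x) => [[]].
  have Ey : y = (ty y, ex y, zz y) by case: (y) => [[]].
  by rewrite c3 -elt_prefix -c4 -Ey -Ex.
have sz5 : size s' <= k by apply: leq_trans sz4 _; rewrite -(size_rcons r x).
have [[L hL]|[he [L lL gL]]] := IH (ty y) (P1 + P')%R (0 + Q')%R s' sz5 v4.
- by left; exists L; exact: hform_conj c4 hL.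
- by right; split; [exact: eform_conj c4 he | exists L => //; exact: gform_conj c4 gL].
Qed.

Lemma classify w :
  (exists L, hform w L) \/ (eform w /\ exists2 L, L <= 1 & gform w L).
Proof.
have [P [Q [s [h vs]]]] := word_elt w.
have c := conjG_Geq h.
case: (classify_elt false P Q (leqnn (size s)) vs) => [[L hL]|[he [L lL gL]]].
  by left; exists L; exact: hform_conj c hL.
by right; split; [exact: eform_conj c he | exists L => //; exact: gform_conj c gL].
Qed.
End Presentation.

(** * Exponent sums, the invariants of the abelianization *)

Definition lval (e : bool) (l : letter) : int :=
  if l.1 == e then (if l.2 then -1 else 1)%R else 0%R.
Definition esum e (w : word) : int := (\sum_(l <- w) lval e l)%R.

Lemma esum_cat e u v : esum e (u ++ v) = (esum e u + esum e v)%R.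
Proof. exact: big_cat. Qed.

Lemma esum_nseq e k l : esum e (nseq k l) = (lval e l *+ k)%R.
Proof.
elim: k => [|k IH]; first by rewrite /esum big_nil.
by rewrite /esum big_cons -/(esum e _) IH mulrS.
Qed.

Lemma lval_linv e l : lval e (linv l) = (- lval e l)%R.
Proof. by case: l => a [|]; rewrite /lval /=; case: eqP; rewrite ?opprK ?oppr0. Qed.

Lemma esum_winv e w : esum e (winv w) = (- esum e w)%R.
Proof.
rewrite /esum /winv big_rev big_map -sumrN.
by apply: eq_bigr => l _; rewrite lval_linv.
Qed.

Lemma esum_Geq m n e u v : Geq m n u v -> esum e u = esum e v.
Proof.
elim=> {u v} [u|u v _ ->|u v w _ -> _ ->|u v l|u v] //.
  rewrite !esum_cat /esum !big_cons lval_linv; ring.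
rewrite /relator !esum_cat !esum_nseq /lval /=; case: e => /=; ring.
Qed.

Lemma esum_conjG m n e u v : conjG m n u v -> esum e u = esum e v.
Proof. by case=> w /(esum_Geq e) <-; rewrite !esum_cat esum_winv; ring. Qed.

Lemma esum_wpow e e' z : esum e (wpow e' z) = if e' == e then z else 0%R.
Proof. by case: z => k; rewrite esum_nseq /lval /=; case: eqP => _; lia. Qed.

(** * Evaluation of words in finite groups *)

Section Evaluation.
Variables (Y : finGroupType) (x : bool -> Y).
Local Open Scope group_scope.

Definition evl (l : letter) : Y := if l.2 then (x l.1)^-1 else x l.1.
Definition ev (w : word) : Y := \prod_(l <- w) evl l.

Lemma ev_nil : ev [::] = 1. Proof. exact: big_nil. Qed.

Lemma ev_cat u v : ev (u ++ v) = ev u * ev v.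
Proof. exact: big_cat. Qed.

Lemma ev_nseq k l : ev (nseq k l) = evl l ^+ k.
Proof.
elim: k => [|k IH]; first exact: ev_nil.
by rewrite /ev big_cons -/(ev _) IH expgS.
Qed.

Lemma evl_linv l : evl (linv l) = (evl l)^-1.
Proof. by case: l => a [|]; rewrite /evl /= ?invgK. Qed.

Lemma ev_winv w : ev (winv w) = (ev w)^-1.
Proof.
elim: w => [|l w IH]; first by rewrite ev_nil invg1.
by rewrite -cat1s winv_cat !ev_cat invMg IH /ev !big_seq1 evl_linv.
Qed.

Lemma ev_Geq m n u v : commute (x false ^+ m) (x true ^+ n) ->
  Geq m n u v -> ev u = ev v.
Proof.
move=> c; elim=> {u v} [u|u v _ ->|u v w _ -> _ ->|u v l|u v] //.
  by rewrite !ev_cat {2 3}/ev !big_cons evl_linv mulKVg.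
rewrite /relator !ev_cat !ev_nseq /evl /=.
rewrite !expVgn !mulgA; congr (_ * _).
by rewrite -(mulgA _ (x false ^+ m)) c mulgA !mulgKV.
Qed.

End Evaluation.

(** The conjugator is the value of a word, so conjugacy is meant in the subgroup generated by the
    two images, which is a quotient of G_mn. *)
Definition fconj m n f g := forall (Y : finGroupType) (x : bool -> Y),
  commute (x false ^+ m)%g (x true ^+ n)%g -> exists w, (ev x f ^ ev x w)%g = ev x g.

Lemma fconj_conjG m n f f' g g' :
  conjG m n f f' -> conjG m n g g' -> fconj m n f g -> fconj m n f' g'.
Proof.
move=> [u hu] [v hv] h Y x c; have [w hw] := h Y x c.
exists (winv u ++ w ++ v); rewrite -(ev_Geq c hu) -(ev_Geq c hv).
rewrite !ev_cat !ev_winv -!conjgE !mulgA -hw -!conjgM.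
by congr conjg; rewrite !mulgA mulgV mul1g.
Qed.

Lemma fconj_sym m n f g : fconj m n f g -> fconj m n g f.
Proof.
move=> h Y x c; have [w hw] := h Y x c.
by exists (winv w); rewrite ev_winv -hw conjgK.
Qed.

(** By contraposition: where the images of f and g are not conjugate, the subgroup generated by the
    images of a and b is the finite quotient sought. *)
Lemma separable_of_fconj m n :
  (forall f g, fconj m n f g -> conjG m n f g) -> conjugacy_separable_Gmn m n.
Proof.
move=> H f g nc; apply: NNPP => nX; apply: nc; apply: H => Y x c.
pose G := <<[set x true; x false]>>%G.
have Gx e : x e \in G by rewrite mem_gen // !inE; case: e; rewrite eqxx ?orbT.
have Gev w : ev x w \in G.
  by apply: group_prod => l _; rewrite /evl; case: l.2; rewrite ?groupV.
pose phi w := subg G (ev x w).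
have surj (z : subg_of G) : exists w, ev x w = sgval z.
  (* In a finite group the generated subgroup consists of products of generators, without
     inverses. *)
  have /gen_prodgP [k [d dA ->]] := subgP z.
  elim/big_ind: _ => [|y1 y2 [w1 <-] [w2 <-]|i _]; first by exists [::]; rewrite ev_nil.
    by exists (w1 ++ w2); rewrite ev_cat.
  by case/set2P: (dA i) => ->; [exists [:: (true, false)] | exists [:: (false, false)]];
    rewrite /ev big_seq1.
apply: NNPP => nw; apply: nX; exists (subg_of G), phi; split; last first.
  case=> z hz; have [w hw] := surj z.
  apply: nw; exists w; move/(congr1 sgval): hz.
  by rewrite hw (morphJ (sgval_morphism G)) ?inE //= /phi !subgK.
split.
- by move=> u v h; rewrite /phi (ev_Geq c h).
- by move=> u v; rewrite /phi ev_cat subgM.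
- by move=> z; have [w hw] := surj z; exists w; rewrite /phi hw sgvalK.
Qed.

(** * Residues modulo N and cyclic quotients *)

Section Residues.
Variable N : nat.
Hypothesis N1 : 1 < N.

Lemma Zp_intr_eq0 (z : int) : (z%:~R = 0 :> 'Z_N)%R -> N %| `|z|.
Proof.
have H k : (k%:R = 0 :> 'Z_N)%R -> N %| k.
  by move/(congr1 val); rewrite /= val_Zp_nat // /dvdn => ->.
case: z => k; first exact: H.
by rewrite NegzE mulrNz => /eqP; rewrite oppr_eq0 abszN => /eqP/H.
Qed.
End Residues.

Lemma fconj_esum m n f g e : fconj m n f g -> esum e f = esum e g.
Proof.
(* N exceeds both 1 and the difference of the two sums, so their congruence modulo N is equality. *)
move=> h; pose N := `|(esum e f - esum e g)%R|.+2.
pose x (e' : bool) : 'Z_N := if e' == e then 1%R else 0%R.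
have cc (y z : 'Z_N) : commute y z by exact: FinRing.zmod_mulgC.
have evE w : ev x w = ((esum e w)%:~R)%R.
  elim: w => [|l w IH]; first by rewrite ev_nil /esum big_nil.
  rewrite /ev /esum !big_cons -/(ev x w) IH -/(esum e w) rmorphD /=.
  rewrite FinRing.zmodMgE; congr (_ + _)%R; rewrite /evl /lval /x.
  case: l => a b /=; case: eqP => _; case: b => //=.
  by rewrite FinRing.zmodVgE oppr0.
have [w hw] := h _ x (cc _ _).
move: hw; rewrite conjgE cc mulgK !evE => /eqP; rewrite -subr_eq0 -rmorphB => /eqP hz.
have := Zp_intr_eq0 (isT : 1 < N) hz.
have [/eqP|pos] := posnP `|(esum e f - esum e g)%R|.
  by rewrite absz_eq0 subr_eq0 => /eqP.
by move/dvdn_leq => /(_ pos); rewrite /N; lia.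
Qed.

(** * The finite chain of tori and its gluing *)

Lemma val_iter_ordS l (k : 'I_l.+1) j : iter j (@ordS _) k = (k + j) %% l.+1 :> nat.
Proof.
elim: j => [|j IH]; first by rewrite addn0 modn_small.
by rewrite iterS /= IH addnS -addn1 modnDml addn1.
Qed.

Section Construction.
Variables (m n : nat).
Hypotheses (m1 : 1 < m) (n1 : 1 < n).
Local Notation mu := (mu m n).

(** The generator of index e translates the e-coordinate of a point by [s e];
    the role of the subgroup spanned by [S e] is played by the annihilator
    of [h e]. *)
Variables (U : finZmodType) (l N : nat) (tok : 'I_l.+1 -> token).
Variables (s : bool -> U) (h : bool -> nat).
Local Open Scope ring_scope.
Let S e : U := s e *+ mu e.

Hypothesis nontorsion : forall e i, (0 < i < mu e)%N -> s e *+ i *+ h e != 0.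
Hypothesis torsion : forall e, S e *+ h e = 0.
Hypothesis tok_valid : forall k, tvalid m n (tok k).
Hypothesis tok_red : forall k, ty (tok k) = ty (tok (ordS k)) ->
  S (~~ ty (tok k)) *~ zz (tok k) != 0.

Definition point := ('I_l.+1 * {ffun bool -> U})%type.
Definition dl e (u : U) : {ffun bool -> U} := [ffun e' => if e' == e then u else 0].
Definition trn (d : {ffun bool -> U}) (p : point) : point := (p.1, p.2 + d).

Lemma dl_same e u : dl e u e = u. Proof. by rewrite ffunE eqxx. Qed.
Lemma dl_other e u : dl e u (~~ e) = 0. Proof. by rewrite ffunE; case: e. Qed.
Lemma dl_other' e u : dl (~~ e) u e = 0. Proof. by rewrite ffunE; case: e. Qed.
Lemma dlD e u v : dl e (u + v) = dl e u + dl e v.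
Proof. by apply/ffunP=> e'; rewrite !ffunE; case: eqP; rewrite ?addr0. Qed.
Lemma dl0 e : dl e 0 = 0.
Proof. by apply/ffunP=> e'; rewrite !ffunE; case: eqP. Qed.
Lemma dlN e u : dl e (- u) = - dl e u.
Proof. by apply/eqP; rewrite -addr_eq0 -dlD addNr dl0. Qed.
Lemma dlMn e u k : dl e (u *+ k) = dl e u *+ k.
Proof. by elim: k => [|k IH]; rewrite ?mulr0n ?dl0 // !mulrS dlD IH. Qed.
Lemma dlMz e u (z : int) : dl e (u *~ z) = dl e u *~ z.
Proof.
case: z => k; first exact: dlMn.
by rewrite (_ : u *~ Negz k = - (u *+ k.+1)) // dlN dlMn.
Qed.

Lemma ffun_boolP e (f g : {ffun bool -> U}) : f e = g e -> f (~~ e) = g (~~ e) -> f = g.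
Proof. by move=> h1 h2; apply/ffunP; case: e h1 h2 => /= h1 h2 []. Qed.

Definition disp k := dl (ty (tok k)) (s (ty (tok k)) *+ ex (tok k))
  + dl (~~ ty (tok k)) (S (~~ ty (tok k)) *~ zz (tok k)).
(** The entry line is a subgroup of one coordinate axis; [exit] is its translate by the syllable
    exponent. *)
Definition entry e (p : point) :=
  [&& ty (tok p.1) == e, p.2 e *+ h e == 0 & p.2 (~~ e) == 0].
Definition exit e (p : point) := entry e (trn (- dl e (s e *+ ex (tok p.1))) p).
Definition fwd (p : point) : point := (ordS p.1, p.2 - disp p.1).
Definition bwd (p : point) : point := (ord_pred p.1, p.2 + disp (ord_pred p.1)).
(** Without gluing, the k-th syllable of f would translate its base point by
    [disp k]. The involution [glue e] identifies the line reached after the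
    i-th power of the generator with a line of the next piece, from which the
    torus part of the syllable leads to the next base point. *)
Definition glue e p := if exit e p then fwd p else if exit e (bwd p) then bwd p else p.

Lemma fwdK : cancel fwd bwd.
Proof. by case=> k xi; rewrite /bwd /fwd /= ordSK subrK. Qed.
Lemma bwdK : cancel bwd fwd.
Proof. by case=> k xi; rewrite /bwd /fwd /= ord_predK addrK. Qed.

Lemma add_dl_same (xi : {ffun bool -> U}) e u : (xi + dl e u) e = xi e + u.
Proof. by rewrite !ffunE eqxx. Qed.

Lemma add_dl_other (xi : {ffun bool -> U}) e u : (xi + dl (~~ e) u) e = xi e.
Proof. by rewrite !ffunE; case: e; rewrite /= addr0. Qed.

Lemma sub_dl_same (xi : {ffun bool -> U}) e u : (xi - dl e u) e = xi e - u.
Proof. by rewrite !ffunE eqxx. Qed.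

Lemma sub_dl_other (xi : {ffun bool -> U}) e u : (xi - dl e u) (~~ e) = xi (~~ e).
Proof. by rewrite !ffunE; case: e; rewrite /= subr0. Qed.

Lemma exitP e p : exit e p -> [/\ ty (tok p.1) = e,
   p.2 e *+ h e = s e *+ ex (tok p.1) *+ h e & p.2 (~~ e) = 0].
Proof.
case/and3P=> /= /eqP E; rewrite sub_dl_same sub_dl_other mulrnBl subr_eq0.
by move=> /eqP ? /eqP ?.
Qed.

Lemma entryP e p : entry e p -> [/\ ty (tok p.1) = e, p.2 e *+ h e = 0 & p.2 (~~ e) = 0].
Proof. by case/and3P=> /eqP ? /eqP ? /eqP ?. Qed.

Lemma disp_own k : disp k (ty (tok k)) = s (ty (tok k)) *+ ex (tok k).
Proof. by rewrite ffunE dl_same dl_other' addr0. Qed.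

Lemma disp_other k : disp k (~~ ty (tok k)) = S (~~ ty (tok k)) *~ zz (tok k).
Proof. by rewrite ffunE dl_same dl_other add0r. Qed.

Lemma sub_disp_own (xi : {ffun bool -> U}) k :
  (xi - disp k) (ty (tok k)) = xi (ty (tok k)) - s (ty (tok k)) *+ ex (tok k).
Proof. by rewrite -disp_own !ffunE. Qed.

Lemma add_disp_other (xi : {ffun bool -> U}) k : (xi + disp k) (~~ ty (tok k)) =
  xi (~~ ty (tok k)) + S (~~ ty (tok k)) *~ zz (tok k).
Proof. by rewrite -disp_other !ffunE. Qed.

(** The two lines differ by [s e *+ ex], which [h e] does not kill since the exponent is strictly
    between 0 and [mu e]. *)
Lemma entry_not_exit e p : entry e p -> ~~ exit e p.
Proof.
move=> /entryP [E h1 _]; apply/negP => /exitP [_ h2 _].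
by have := @nontorsion e (ex (tok p.1)); rewrite -h2 h1 eqxx -{1}E => /(_ (tok_valid _)).
Qed.

Lemma exit_fwd e p : exit e p -> ~~ exit e (fwd p).
Proof.
move=> /exitP [E h1 _]; apply/negP => /exitP [E' h2 _].
have h3 : (fwd p).2 e *+ h e = 0.
  by rewrite -E sub_disp_own E mulrnBl h1 subrr.
have := @nontorsion e (ex (tok (fwd p).1)).
by rewrite -h2 h3 eqxx -{1}E' => /(_ (tok_valid _)).
Qed.

Lemma glueK e : involutive (glue e).
Proof.
move=> p; rewrite {2}/glue; case: ifP => [o|no].
  by rewrite /glue (negPf (exit_fwd o)) fwdK o.
case: ifP => [o|no']; first by rewrite /glue o bwdK.
by rewrite /glue no no'.
Qed.

(** An entry line could only be glued backwards, to a predecessor of the same type; but then the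
    torus part between them is nonzero by [tok_red] and moves the point off that predecessor's exit
    line. *)
Lemma entry_glue e p : entry e p -> glue e p = p.
Proof.
move=> i; rewrite /glue (negPf (entry_not_exit i)); case: ifP => // /exitP [E _ h1].
have [E' _ h2] := entryP i; exfalso.
have := @tok_red (bwd p).1; rewrite /= ord_predK E E' => /(_ erefl) /eqP; apply.
by move: h1; rewrite -E add_disp_other E h2 add0r.
Qed.

Lemma entry_trn e p u : u *+ h e = 0 -> entry e (trn (dl e u) p) = entry e p.
Proof.
move=> hu; rewrite /entry /trn /= !ffunE eqxx mulrnDl hu addr0.
by rewrite (_ : ~~ e == e = false) ?addr0 //; case: (e).
Qed.

Lemma trn_trn d d' p : trn d (trn d' p) = trn (d' + d) p.
Proof. by rewrite /trn /= addrA. Qed.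

Lemma exit_trn e p u : u *+ h e = 0 -> exit e (trn (dl e u) p) = exit e p.
Proof.
by move=> hu; rewrite /exit trn_trn addrC -trn_trn entry_trn.
Qed.

Lemma glue_trn e p : glue e (trn (dl e (S e)) p) = trn (dl e (S e)) (glue e p).
Proof.
have bt : bwd (trn (dl e (S e)) p) = trn (dl e (S e)) (bwd p).
  by rewrite /bwd /trn /= addrAC.
rewrite /glue bt !exit_trn //; case: ifP => _; last by case: ifP.
by rewrite /fwd /trn /= addrAC.
Qed.

(** Conjugation by [swap] subtracts the weight at the start and adds it at the end, so -1 on an
    entry line contributes +1 there. *)
Definition wt e p : int := if exit e p then 1 else if entry e p then -1 else 0.

Lemma wt_trn e p : wt e (trn (dl e (S e)) p) = wt e p.
Proof. by rewrite /wt exit_trn // entry_trn. Qed.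

(** * Permutations of weighted points *)

Definition space := (point * 'Z_N)%type.

Definition swapf e (v : space) : space := (glue e v.1, v.2 + (wt e v.1)%:~R).
Lemma swapf_inj e : injective (swapf e).
Proof.
move=> [p c] [p' c'] E; have /(can_inj (glueK e)) /= Ep := congr1 fst E.
by move/(congr1 snd): E; rewrite /= Ep => /addIr ->.
Qed.
Definition swap e : {perm space} := perm (@swapf_inj e).

Definition shiftf d (v : space) : space := (trn d v.1, v.2).
Lemma shiftf_inj d : injective (shiftf d).
Proof.
move=> [[k xi] c] [[k' xi'] c'] E; have /addIr /= -> := congr1 (fun v => v.1.2) E.
by have /= -> := congr1 (fun v => v.1.1) E; have /= -> := congr1 snd E.
Qed.
Definition shift d : {perm space} := perm (@shiftf_inj d).

Definition wshiftf a (v : space) : space := (v.1, v.2 + a).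
Lemma wshiftf_inj a : injective (wshiftf a).
Proof.
move=> [p c] [p' c'] E; have /addIr /= -> := congr1 snd E.
by have /= -> := congr1 fst E.
Qed.
Definition wshift a : {perm space} := perm (@wshiftf_inj a).

Lemma shiftM d d' : (shift d * shift d')%g = shift (d + d').
Proof. by apply/permP=> v; rewrite permM !permE /shiftf /= trn_trn. Qed.

Lemma shift0 : shift 0 = 1%g.
Proof. by apply/permP=> [[[k xi] c]]; rewrite !permE /shiftf /trn /= addr0. Qed.

Lemma shiftX d k : (shift d ^+ k)%g = shift (d *+ k).
Proof.
elim: k => [|k IH]; first by rewrite shift0.
by rewrite expgS IH shiftM mulrS.
Qed.

Lemma shiftV d : (shift d)^-1%g = shift (- d).
Proof.
apply: (mulgI (shift d)); rewrite mulgV shiftM subrr shift0 //.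
Qed.

(** The gluing commutes with the translation by [S e], so the conjugation does
    not affect the [mu e]-th powers, and these still commute with each other. *)
Definition gen_perm e : {perm space} := (shift (dl e (s e)) ^ swap e)%g.

Lemma gen_permX e i : (gen_perm e ^+ i)%g = (shift (dl e (s e *+ i)) ^ swap e)%g.
Proof. by rewrite /gen_perm -conjXg shiftX dlMn. Qed.

Lemma gen_perm_mu e : (gen_perm e ^+ mu e)%g = shift (dl e (S e)).
Proof.
rewrite gen_permX; apply/conjg_fixP/commgP.
by apply/permP=> v; rewrite !permM !permE /swapf /shiftf /= glue_trn wt_trn.
Qed.

Lemma gen_perm_comm : commute (gen_perm false ^+ m)%g (gen_perm true ^+ n)%g.
Proof.
by rewrite (gen_perm_mu false) (gen_perm_mu true) /commute !shiftM addrC.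
Qed.

Lemma ev_cw e z : ev gen_perm (cw m n e z) = shift (dl e (S e *~ z)).
Proof.
have mu1 := mu_gt1 m1 n1 e.
rewrite /cw; case: z => k.
  by rewrite -PoszM /wpow ev_nseq /evl /= expgM gen_perm_mu shiftX dlMz pmulrn.
have -> : ((mu e)%:Z * Negz k)%R = Negz (mu e * k.+1).-1 by lia.
rewrite /wpow ev_nseq /evl /= prednK; last by lia.
by rewrite expgVn expgM gen_perm_mu shiftX shiftV dlMz NegzE mulrNz pmulrn.
Qed.

(** Weights are added to but never read. This lets the weight gained at a fixed point pass to
    conjugates. *)
Lemma wshift_gen_perm a e : commute (gen_perm e) (wshift a).
Proof.
have cs : commute (swap e) (wshift a).
  by apply/permP=> v; rewrite !permM !permE /swapf /wshiftf /= addrAC.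
have ct d : commute (shift d) (wshift a).
  by apply/permP=> v; rewrite !permM !permE.
apply/commute_sym; rewrite /gen_perm conjgE.
apply: commuteM; first by apply: commuteV; exact: commute_sym.
by apply: commuteM; exact: commute_sym.
Qed.

Lemma wshift_ev a w : commute (ev gen_perm w) (wshift a).
Proof.
elim: w => [|[e b] w IH]; first by rewrite ev_nil; exact/commute_sym/commute1.
rewrite -cat1s ev_cat; apply/commute_sym/commuteM; last exact/commute_sym.
rewrite /ev big_seq1 /evl /=; case: b; last exact/commute_sym/wshift_gen_perm.
exact/commuteV/commute_sym/wshift_gen_perm.
Qed.

(** * Paths of points and the weight they collect *)

Definition pass e i (p : point) : point := glue e (trn (dl e (s e *+ i)) (glue e p)).
(** How much a syllable falls short of the maximal weight 2. *)
Definition defect e i (p : point) : nat :=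
  (`|(1 + wt e (glue e p))%R| + `|(1 - wt e (trn (dl e (s e *+ i)) (glue e p)))%R|)%N.
Definition step t p := trn (dl (~~ ty t) (S (~~ ty t) *~ zz t)) (pass (ty t) (ex t) p).

Lemma gen_perm_pass e i p c : (gen_perm e ^+ i)%g (p, c) = (pass e i p, c + 2%:R - (defect e i p)%:R).
Proof.
have -> : (p, c) = swap e (glue e p, c - (wt e (glue e p))%:~R).
  by rewrite permE /swapf /= glueK subrK.
rewrite gen_permX permJ !permE /swapf /shiftf /=; congr pair; rewrite /defect.
have bnd q : (wt e q <= 1) && (- 1 <= wt e q) by rewrite /wt; case: ifP => // _; case: ifP.
set a := wt e _; set b := wt e _.
have [/andP[a1 a2] /andP[b1 b2]] : (a <= 1) && (-1 <= a) /\ (b <= 1) && (-1 <= b) by split; apply: bnd.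
have E : (2 - (`|(1 + a)%R| + `|(1 - b)%R|)%N%:Z)%R = b - a by lia.
set D := (_ + _)%N in E *.
have E1 : 2%:R - D%:R = b%:~R - a%:~R :> 'Z_N by rewrite -rmorphB /= -E rmorphB.
by rewrite -(addrA c 2%:R) E1 addrA addrAC.
Qed.

Lemma defect_le e i p : (defect e i p <= 4)%N.
Proof.
have bnd q : (wt e q <= 1) && (- 1 <= wt e q) by rewrite /wt; case: ifP => // _; case: ifP.
rewrite /defect; have := bnd (glue e p); have := bnd (trn (dl e (s e *+ i)) (glue e p)).
lia.
Qed.

(** Both extreme weights must occur, so the path starts on an entry line and ends on the exit line
    of the same piece. The exponents then agree, since [h e] kills their difference times [s e] and
    that difference is less than [mu e]. *)
Lemma defect0P e i p : (0 < i < mu e)%N -> defect e i p = 0%N ->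
  [/\ entry e p, i = ex (tok p.1) &
    pass e i p = (ordS p.1, p.2 - dl (~~ e) (S (~~ e) *~ zz (tok p.1)))].
Proof.
move=> hi /eqP; rewrite addn_eq0 !absz_eq0 addrC addr_eq0 subr_eq0 => /andP[/eqP w1 /eqP w2].
have [io no] : entry e (glue e p) /\ ~~ exit e (glue e p).
  by move: w1; rewrite /wt; case: ifP => // _; case: ifP.
have ep : glue e p = p by rewrite -{2}(glueK e p) (entry_glue io).
rewrite /pass ep in io w2 *.
have o : exit e (trn (dl e (s e *+ i)) p).
  by move: w2; rewrite /wt; case: ifP => // _; case: ifP.
have [E h1 h2] := exitP o; have [_ h3 _] := entryP io.
have ei : i = ex (tok p.1).
  move: h1; rewrite /= add_dl_same mulrnDl h3 add0r => h1.
  have hk := tok_valid p.1; rewrite /tvalid /= [ty _]E in hk.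
  have [lt|lt|//] := ltngtP i (ex (tok p.1)); exfalso.
    have := @nontorsion e (ex (tok p.1) - i); rewrite mulrnBr ?(ltnW lt) //.
    rewrite mulrnBl h1 subrr eqxx => H; suff: false by []; apply: H; lia.
  have := @nontorsion e (i - ex (tok p.1)); rewrite mulrnBr ?(ltnW lt) //.
  rewrite mulrnBl h1 subrr eqxx => H; suff: false by []; apply: H; lia.
split => //; rewrite /glue o /fwd /=; congr pair.
by rewrite /disp [ty _]E -ei opprD addrA addrK.
Qed.

Lemma entry_base k : entry (ty (tok k)) (k, 0).
Proof. by rewrite /entry /= !ffunE mul0rn !eqxx. Qed.

Lemma pass_base k : let e := ty (tok k) in
  pass e (ex (tok k)) (k, 0) = (ordS k, - dl (~~ e) (S (~~ e) *~ zz (tok k)))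
  /\ defect e (ex (tok k)) (k, 0) = 0%N.
Proof.
move=> e; have i := entry_base k; rewrite /pass /defect (entry_glue i).
have o : exit e (trn (dl e (s e *+ ex (tok k))) (k, 0)).
  by rewrite /exit trn_trn subrr /trn addr0.
rewrite /glue o /wt o (negPf (entry_not_exit i)) i; split => //.
by rewrite /fwd /trn /disp /= -/e; congr pair; rewrite add0r opprD addrA subrr add0r.
Qed.

Fixpoint run r p : point := if r is t :: r' then run r' (step t p) else p.
Fixpoint deficit r p : nat :=
  if r is t :: r' then (defect (ty t) (ex t) p + deficit r' (step t p))%N else 0%N.

Lemma run_rcons r t p : run (rcons r t) p = step t (run r p).
Proof. by elim: r p => [|t' r IH] p //=. Qed.

Lemma deficit_rcons r t p :
  deficit (rcons r t) p = (deficit r p + defect (ty t) (ex t) (run r p))%N.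
Proof. by elim: r p => [|t' r IH] p /=; rewrite ?addn0 // IH addnA. Qed.

Lemma deficit_le r p : (deficit r p <= 4 * size r)%N.
Proof.
elim: r p => [|t r IH] p //=; have := IH (step t p); have := defect_le (ty t) (ex t) p.
by rewrite mulnS; exact: leq_add.
Qed.

Lemma ev_tw r p c :
  ev gen_perm (tw m n r) (p, c) = (run r p, c + (2 * size r)%:R - (deficit r p)%:R).
Proof.
elim: r p c => [|t r IH] p c; first by rewrite ev_nil perm1 /= muln0 addr0 subr0.
rewrite tw_cons /tokw !ev_cat ev_nseq ev_cw !permM /evl /= gen_perm_pass.
rewrite [shift _ _]permE /shiftf /= IH -/(step t p); congr pair.
rewrite mulnS !natrD; ring.
Qed.

Fixpoint follows (R : rel token) r k :=
  if r is t :: r' then R t (tok k) && follows R r' (ordS k) else true.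

Lemma follows_nth R d r k j : follows R r k -> (j < size r)%N ->
  R (nth d r j) (tok (iter j (@ordS _) k)).
Proof.
elim: r k j => [|t r IH] k j //= /andP[h1 h2]; case: j => [|j] //= hj.
by rewrite -iterS iterSr; apply: IH.
Qed.

Lemma run_base r k : follows eq_op r k ->
  run r (k, 0) = (iter (size r) (@ordS _) k, 0) /\ deficit r (k, 0) = 0%N.
Proof.
elim: r k => [|t r IH] k //= /andP[/eqP -> /IH [h1 h2]].
have [h3 h4] := pass_base k.
have -> : step (tok k) (k, 0) = (ordS k, 0).
  by rewrite /step h3 /trn /=; congr pair; rewrite addNr.
by rewrite h1 h2 h4 -iterS iterSr.
Qed.

Lemma step_defect0 t p : tvalid m n t -> defect (ty t) (ex t) p = 0%N ->
  [/\ ty t = ty (tok p.1), ex t = ex (tok p.1), p.2 (~~ ty t) = 0 &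
   step t p = (ordS p.1,
     p.2 + dl (~~ ty t) (S (~~ ty t) *~ (zz t - zz (tok p.1))))].
Proof.
move=> vt d0; have [i h1 h2] := defect0P vt d0; have [E _ h3] := entryP i.
split => //; rewrite /step h2 /trn /=; congr pair.
by rewrite mulrzBr dlD dlN -addrA; congr (_ + _); rewrite addrC.
Qed.

Lemma deficit0_types r p : all (tvalid m n) r -> deficit r p = 0%N ->
  follows (fun t t' => ty t == ty t') r p.1.
Proof.
elim: r p => [|t r IH] p //= /andP[vt vr] /eqP; rewrite addn_eq0 => /andP[/eqP d1 /eqP d2].
have [-> _ _ Es] := step_defect0 vt d1; rewrite eqxx /=.
by have := IH _ vr d2; rewrite Es.
Qed.

(** The torus exponent of [t] is determined by its residue in [U]. *)
Definition z_rigid (t : token) := forall k, ty (tok k) = ty t ->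
  S (~~ ty t) *~ (zz t - zz (tok k)) = 0 -> zz t = zz (tok k).

(** Read backwards from the end: a step without defect changes only the coordinate [~~ ty t], which
    was 0 before it. So its start is also a base point, and rigidity makes the torus exponents
    equal. *)
Lemma run_to_base r p k : all (tvalid m n) r -> (forall t, t \in r -> z_rigid t) ->
  deficit r p = 0%N -> run r p = (k, 0) -> p.2 = 0 /\ follows eq_op r p.1.
Proof.
elim: r p => [|t r IH] p //=; first by move=> _ _ _ ->.
case/andP=> vt vr hz /eqP; rewrite addn_eq0 => /andP[/eqP d1 /eqP d2] hrun.
have [E Ex h0 Es] := step_defect0 vt d1.
have [|h1 h2] := IH _ vr _ d2 hrun; first by move=> t' ht'; apply: hz; rewrite inE ht' orbT.
rewrite Es /= in h1 h2.
have p0 : p.2 = 0.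
  apply: (@ffun_boolP (ty t)); last by rewrite h0 ffunE.
  by have := congr1 (fun f : {ffun bool -> U} => f (ty t)) h1; rewrite add_dl_other.
split => //; rewrite h2 andbT; apply/eqP.
have := congr1 (fun f : {ffun bool -> U} => f (~~ ty t)) h1.
rewrite p0 add0r dl_same ffunE => /(hz t (mem_head _ _) _ (esym E)).
by move: E Ex; case: (t) => [[? ?] ?]; case: (tok p.1) => [[? ?] ?]; rewrite /ty /ex /zz /= => -> -> ->.
Qed.

(** At a change of type the point lies on the entry lines of both types, which
    meet only in the base point. *)
Lemma closed_mixed_base r t p e : all (tvalid m n) (rcons r t) ->
  (forall t', t' \in rcons r t -> z_rigid t') ->
  deficit (rcons r t) p = 0%N -> run (rcons r t) p = p ->
  entry e p -> e != ty t -> p.2 = 0.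
Proof.
move=> vr hz; rewrite deficit_rcons run_rcons => /eqP; rewrite addn_eq0.
case/andP=> /eqP d1 /eqP d2 hrun /entryP [_ _ hp] he.
move: vr; rewrite all_rcons => /andP[vt vr].
have [_ _ h0 Es] := step_defect0 vt d2.
have [||//] := @run_to_base r p (run r p).1 vr _ d1.
  by move=> t' ht'; apply: hz; rewrite mem_rcons inE ht' orbT.
rewrite [LHS]surjective_pairing; congr pair.
apply: (@ffun_boolP (ty t)); last by rewrite h0 ffunE.
have hp' : p.2 (ty t) = 0 by move: hp he; case: (e); case: (ty t).
by move: hp'; rewrite -{1}hrun Es /= add_dl_other ffunE.
Qed.

Definition elt_start e P Q p : point :=
  trn (dl (~~ e) (S (~~ e) *~ Q)) (trn (dl e (S e *~ P)) p).

Lemma ev_elt e P Q r p c : ev gen_perm (elt m n e P Q r) (p, c) =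
  (run r (elt_start e P Q p),
   c + (2 * size r)%:R - (deficit r (elt_start e P Q p))%:R).
Proof.
rewrite /elt !ev_cat !ev_cw !permM [shift _ (p, c)]permE /shiftf /=.
by rewrite [shift _ _]permE /shiftf /= ev_tw.
Qed.

Lemma fconj_fixed f g p c : fconj m n f g -> ev gen_perm f (p, 0) = (p, c) ->
  exists p' a, ev gen_perm g (p', a) = (p', a + c).
Proof.
move=> hfc hf; have [w hw] := hfc _ _ gen_perm_comm.
case E : (ev gen_perm w (p, 0)) => [p' a]; exists p', a; rewrite -hw -E permJ hf.
have -> : (p, c) = wshift c (p, 0) by rewrite permE /wshiftf /= add0r.
by rewrite -permM -wshift_ev permM E permE.
Qed.

(** A syllable earns at most 2, so a path of at most L syllables that collects 2L has exactly L of
    them, all without defect. *)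
Lemma fconj_run e P s0 e' P' Q' r : N = (4 * l.+1).+1 ->
  size s0 = l.+1 -> follows eq_op s0 ord0 -> S e *~ P = 0 -> (size r <= l.+1)%N ->
  fconj m n (elt m n e P 0 s0) (elt m n e' P' Q' r) ->
  exists p, [/\ size r = l.+1, deficit r (elt_start e' P' Q' p) = 0%N &
    run r (elt_start e' P' Q' p) = p].
Proof.
move=> EN sz0 fol SP szr /fconj_fixed H.
have [|p [a]] := H (ord0, 0) (2 * l.+1)%:R.
  rewrite ev_elt /elt_start SP mulr0z !dl0 /trn /= !addr0.
  have [-> ->] := run_base fol; rewrite sz0 subr0 add0r; congr (_, _, _).
  by apply/val_inj; rewrite [LHS]val_iter_ordS add0n modnn.
rewrite ev_elt; set q := elt_start _ _ _ _; move=> E; exists p.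
have E1 := congr1 fst E; have E2 := congr1 snd E; rewrite /= in E1 E2.
have N1 : (1 < N)%N by rewrite EN.
have dl4 := deficit_le r q.
(* The missing weight lies between 0 and 4L, below [N], so vanishing modulo [N] makes it zero. *)
have : ((2 * l.+1 - 2 * size r + deficit r q)%N%:Z)%:~R = 0 :> 'Z_N.
  rewrite -[LHS]/((_ : nat)%:R) natrD natrB; last by rewrite leq_mul2l.
  by move: E2; rewrite -addrA => /addrI <-; ring.
move/(Zp_intr_eq0 N1); rewrite absz_nat => dv.
have [E0|pos] := posnP (2 * l.+1 - 2 * size r + deficit r q)%N.
  by rewrite -/q; split => //; lia.
by have := dvdn_leq pos dv; rewrite EN; lia.
Qed.
End Construction.

(** * Cyclic sequences and bounds on exponents *)

Lemma cycle_nth T (R : rel T) x p i : path.cycle R (x :: p) -> i <= size p ->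
  R (nth x (x :: p) i) (nth x (x :: p) (i.+1 %% (size p).+1)).
Proof.
move=> /= /(pathP x) h hi; have := h i; rewrite size_rcons ltnS => /(_ hi).
rewrite -rcons_cons !nth_rcons /= ltnS hi.
move: hi; rewrite leq_eqVlt => /orP[/eqP ->|lt]; first by rewrite ltnn eqxx modnn.
by rewrite lt modn_small.
Qed.

Lemma nth_rot T (x : T) k s j : k <= size s -> j < size s ->
  nth x (rot k s) j = nth x s ((k + j) %% size s).
Proof.
move=> hk hj; rewrite /rot nth_cat size_drop nth_drop.
case: ltnP => h; first by rewrite modn_small //; lia.
rewrite nth_take; last by lia.
rewrite (_ : k + j = size s + (j - (size s - k))); last by lia.
by rewrite modnDl modn_small //; lia.
Qed.

Lemma nth_follows l (tok : 'I_l.+1 -> token) d r k :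
  (forall j, j < size r -> nth d r j = tok (iter j (@ordS _) k)) ->
  follows tok eq_op r k.
Proof.
elim: r k => [|t r IH] k //= h; apply/andP; split; first by apply/eqP; exact: (h 0).
by apply: IH => j hj; rewrite -iterSr; exact: (h j.+1).
Qed.

Lemma esum_elt m n e P s :
  esum e (elt m n e P 0 s) = ((mu m n e)%:Z * P + esum e (tw m n s))%R.
Proof. by rewrite /elt cw0 /= esum_cat esum_wpow eqxx. Qed.

Lemma zz_le_sum (s : seq token) t : t \in s -> `|zz t| <= \sum_(t' <- s) `|zz t'|.
Proof.
elim: s => [//|t' s IH]; rewrite inE big_cons => /orP[/eqP ->|/IH h].
  exact: leq_addr.
by apply: leq_trans h _; exact: leq_addl.
Qed.

Lemma absz_sub_le (a b : int) k : `|a| <= k -> `|b| <= k -> `|(a - b)%R| <= 2 * k.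
Proof. lia. Qed.

(** * Choice of the moduli and comparison of f with g *)

Section Separation.
Variables m n : nat.
Hypotheses (m1 : 1 < m) (n1 : 1 < n).
Local Notation mu := (mu m n).

Lemma muz_neq0 e : ((mu e)%:Z != 0)%R.
Proof. by have := mu_gt1 m1 n1 e; lia. Qed.

Section Moduli.
Variables (B : nat) (mo : bool) (e0 : bool).
(** [M] is [q e * mu e] for both values of [e], and [q e] exceeds the difference of any two torus
    exponents bounded by [B]. *)
Let M := m * n * (2 * B).+1.
Let q e := mu (~~ e) * (2 * B).+1.
(** If all syllables of f have type e0, then f fixes a point only if the torus
    power of type e0 acts trivially, so the step of e0 is chosen of order
    [mu e0]. *)
Definition gen_step e : 'Z_M := if mo && (e == e0) then (q e)%:R%R else 1%R.
Definition gen_tors e : nat := if mo && (e == e0) then 1 else q e.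
Local Open Scope ring_scope.

Let M1 : (1 < M)%N. Proof. by rewrite /M; nia. Qed.
Let qM e : (q e * mu e = M)%N. Proof. by rewrite /q /M; case: e => /=; lia. Qed.
Let q0 e : (2 * B < q e)%N.
Proof. by rewrite /q; have := mu_gt1 m1 n1 (~~ e); nia. Qed.

(** The factor [q e] sits either in the step or in the annihilator, so both cases share one
    computation. *)
Lemma gen_step_tors e i : gen_step e *+ i *+ gen_tors e = (q e * i)%:R.
Proof.
rewrite /gen_step /gen_tors; case: ifP => _; first by rewrite mulr1n -mulrnA.
by rewrite -mulrnA mulnC.
Qed.

Lemma gen_nontorsion e i : (0 < i < mu e)%N -> gen_step e *+ i *+ gen_tors e != 0.
Proof.
move=> /andP[i0 imu]; rewrite gen_step_tors; apply/eqP => h.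
have /= := @Zp_intr_eq0 M M1 (q e * i)%N h.
rewrite -(qM e) dvdn_pmul2l; last by have := q0 e; lia.
by move/(dvdn_leq i0); rewrite leqNgt imu.
Qed.

Lemma gen_torsion e : gen_step e *+ mu e *+ gen_tors e = 0.
Proof. by rewrite gen_step_tors qM; apply/val_inj; rewrite /= val_Zp_nat // modnn. Qed.

(** The step on the coordinate [~~ e] is 1, so [q (~~ e)] divides z, which is smaller in absolute
    value. *)
Lemma gen_rigid e (z : int) : (mo -> e = e0) -> (`|z| <= 2 * B)%N ->
  gen_step (~~ e) *+ mu (~~ e) *~ z = 0 -> z = 0.
Proof.
move=> he hz; rewrite /gen_step (_ : mo && _ = false); last first.
  by case: mo he => // /(_ isT) ->; case: (e0).
rewrite pmulrn -mulrzA => /(@Zp_intr_eq0 M M1).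
rewrite abszM absz_nat -(qM (~~ e)) mulnC dvdn_pmul2l; last by have := mu_gt1 m1 n1 (~~ e); lia.
have [/eqP|pos] := posnP `|z|%N; first by rewrite absz_eq0 => /eqP.
by move/(dvdn_leq pos); have := q0 (~~ e); lia.
Qed.

Lemma gen_mono_step : mo -> gen_tors e0 = 1%N /\ gen_step e0 *+ mu e0 = 0.
Proof.
move=> h; have t1 : gen_tors e0 = 1%N by rewrite /gen_tors h eqxx.
by split => //; have := gen_torsion e0; rewrite t1 mulr1n.
Qed.
End Moduli.

Lemma separation_step f g L L' : hform m n f L -> gform m n g L' -> L' <= L ->
  fconj m n f g -> conjG m n f g.
Proof.
move=> [e [P [s0 [EL cf [vs ns hs ms] cyc]]]] hg leL hfc.
have [e' [P' [Q' [r [cg szr hr]]]]] : exists e' P' Q' r,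
    [/\ conjG m n g (elt m n e' P' Q' r), size r <= L &
      r = [::] \/ (Q' = 0%R /\ nform m n e' P' r)].
  case: hg => [[e' [P' [Q' [_ cg]]]]|[e' [P' [r [sr cg nr]]]]].
    by exists e', P', Q', [::]; split => //; left.
  by exists e', P', 0%R, r; rewrite -sr; split => //; right.
have {}hfc := fconj_conjG cf cg hfc.
have eqs := fconj_esum e hfc.
suff H : conjG m n (elt m n e P 0 s0) (elt m n e' P' Q' r).
  have E := conjG_equiv m n.
  by apply: (Equivalence_Transitive _ _ _ cf); apply: (Equivalence_Transitive _ _ _ H);
    apply: Equivalence_Symmetric.
move: {cf cg hg L' leL} L EL szr => _ ->.
case: s0 vs ns hs ms cyc hfc eqs => [//|t0 s'] vs _ hs ms cyc hfc eqs szr.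
set s0 := t0 :: s' in vs hs ms cyc hfc eqs szr *.
pose tok (k : 'I_(size s').+1) := nth t0 s0 k.
pose mo := mono e s0.
pose B := \sum_(t <- s0 ++ r) `|zz t|.
pose st := gen_step B mo e; pose tr := gen_tors B mo e.
have nontors := gen_nontorsion B mo e.
have tors := gen_torsion B mo e.
have tokin k : tok k \in s0 by exact: mem_nth.
have tok_valid k : tvalid m n (tok k) by exact: (allP vs).
have mo_ty k : mo -> ty (tok k) = e by move/allP/(_ _ (tokin k))/eqP.
have rigid k (z : int) : `|z| <= 2 * B ->
    (st (~~ ty (tok k)) *+ mu (~~ ty (tok k)) *~ z = 0)%R -> z = 0%R.
  by apply: gen_rigid => //; exact: mo_ty.
have zB t : t \in s0 ++ r -> `|zz t| <= B by exact: zz_le_sum.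
have tok_red k : ty (tok k) = ty (tok (ordS k)) ->
    (st (~~ ty (tok k)) *+ mu (~~ ty (tok k)) *~ zz (tok k) != 0)%R.
  move=> E; apply/eqP => /rigid E0.
  have := cycle_nth cyc (ltn_ord k); rewrite -/s0 -[nth _ _ (_ %% _)]/(tok (ordS k)).
  rewrite -/(tok k) /tred -E eqxx /= E0 //.
  by have := zB (tok k); rewrite mem_cat tokin => /(_ isT); lia.
have S0 : mo -> (st e *+ mu e = 0)%R by move=> h; have [] := gen_mono_step B e h.
have hP : mo \/ P = 0%R by case: ms => [?|[? _]]; [left | right].
have SP : (st e *+ mu e *~ P = 0)%R.
  by case: hP => [/S0 -> | ->]; rewrite ?mul0rz ?mulr0z.
have fol : follows tok eq_op s0 ord0.
  by apply: (@nth_follows _ _ t0) => j hj; rewrite /tok val_iter_ordS add0n modn_small.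
have [p [szL d0 hrun]] :=
  fconj_run (s0 := s0) m1 n1 nontors tors tok_valid tok_red erefl erefl fol SP szr hfc.
case: hr => [r0|[Q0 [vr nr hr mr]]]; first by rewrite r0 in szL.
rewrite Q0 in hrun d0 hfc eqs *.
set q := elt_start _ _ _ _ _ _ _ in hrun d0.
have fty := deficit0_types m1 n1 nontors tok_valid tok_red vr d0.
have zr t : t \in r -> z_rigid m n tok st t.
  move=> ht k E; rewrite -E => /rigid H; apply/eqP; rewrite -subr_eq0; apply/eqP/H.
  by apply: absz_sub_le; apply: zB; rewrite mem_cat ?tokin ?ht ?orbT.
have tyr j : j < size r -> ty (nth t0 r j) = ty (tok (iter j (@ordS _) q.1)).
  by move=> hj; apply/eqP; exact: (follows_nth t0 fty hj).
have inq : entry tok tr e' q.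
  case: (r) nr vr hr d0 => [//|t r2] _ /= /andP[vt _] <- /eqP; rewrite addn_eq0.
  by case/andP=> /eqP /(defect0P m1 n1 nontors tok_valid tok_red vt) [].
have hd0 : ty (nth t0 r 0) = e' by rewrite nth0; case: (r) nr hr.
have r0 : 0 < size r by rewrite szL.
have moe' : mo -> e' = e by move=> h; rewrite -hd0 (tyr _ r0) /= mo_ty.
(* The types in [r] copy those of f around the whole chain, so [r] of a single type would make f so
   too. *)
have nmo : ~~ mo -> P' = 0%R /\ ty (last (e', 0, 0%R) r) <> e'.
  move=> h; case: mr => // hm; exfalso; move/negP: h; apply.
  have tye' k : ty (tok k) = e'.
    (* The number of steps along the cycle from [q.1] to [k]. *)
    pose j := ((size s').+1 - q.1 + k) %% (size s').+1.
    have hj : j < size r by rewrite szL ltn_pmod.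
    have -> : k = iter j (@ordS _) q.1.
      apply/val_inj; rewrite [RHS]val_iter_ordS modnDmr addnA subnKC; last exact/ltnW.
      by rewrite modnDl modn_small.
    by rewrite -tyr //; apply/eqP; apply: (allP hm); exact: mem_nth.
  have Ee : e = e' by rewrite -hs -(tye' ord0).
  by apply/allP=> t /(nthP t0) [j hj <-]; rewrite Ee -(tye' (Ordinal hj)).
have qp : q = p.
  (* The torus prefix of g acts trivially: its exponent is 0, or all types agree and the step has
     order dividing [mu e]. *)
  suff E : (st e' *+ mu e' *~ P')%R = 0%R.
    by rewrite /q /elt_start E mulr0z !dl0 /trn /= !addr0; case: (p).
  have [h|/nmo[-> _]] := boolP mo; last by rewrite mulr0z.
  by rewrite (moe' h) (S0 h) mul0rz.
rewrite qp in inq d0 hrun.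
have p0 : p.2 = 0%R.
  (* With a single type the annihilator is 1, so the entry line is just the base point; otherwise
     the cut at a change of type applies. *)
  have [h|/nmo[_ hl]] := boolP mo.
    have [_ i1 i2] := entryP inq; apply: (@ffun_boolP _ e'); rewrite ffunE //.
    by move: i1; rewrite (moe' h) /tr; have [-> _] := gen_mono_step B e h; rewrite mulr1n.
  case/lastP: (r) nr hl vr zr d0 hrun => [//|r1 t] _; rewrite last_rcons => hl vr1 zr1 d1 hrun1.
  apply: (closed_mixed_base m1 n1 nontors tok_valid tok_red vr1 zr1 d1 hrun1 inq).
  by apply/eqP => E; apply: hl.
have [|_ fr] := @run_to_base _ _ m1 n1 _ _ _ _ _ nontors tok_valid tok_red r p p.1 vr zr d0.
  by rewrite hrun -p0; case: (p).
have Er : r = rot p.1 s0.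
  apply: (@eq_from_nth _ t0); first by rewrite size_rot szL.
  move=> j hj; rewrite nth_rot; [|exact/ltnW|by rewrite szL in hj].
  by rewrite (eqP (follows_nth t0 fr hj)) /tok val_iter_ordS.
have es := cat_take_drop p.1 s0.
have rotc : conjG m n (elt m n e P 0 s0) (elt m n e P 0 r).
  by rewrite Er -{1}es /rot; apply: elt_rot => //; rewrite es.
(* With a single type it remains to compare [P] and [P']: rotation preserves the exponent sum, which
   then determines them. *)
have [h|h] := boolP mo; last first.
  have [P0 _] := nmo h; case: hP => [h'|P0']; first by rewrite h' in h.
  by move: rotc; rewrite P0 P0' /elt !cw0.
rewrite (moe' h) in eqs *; suff -> : P' = P by [].
by have := esum_conjG e rotc; rewrite eqs !esum_elt => /addIr /(mulfI (muz_neq0 e)).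
Qed.

End Separation.

(** * Combination of the elliptic and hyperbolic cases *)

Theorem mainTheorem1 (m n : nat) : 1 < m -> 1 < n -> conjugacy_separable_Gmn m n.
Proof.
move=> m1 n1; apply: separable_of_fconj => f g hfc.
have H L f' g' L' : hform m n f' L -> gform m n g' L' -> L' <= L ->
  fconj m n f' g' -> conjG m n f' g' by exact: separation_step.
have gh w L : hform m n w L -> gform m n w L.
  by move=> [e [P [s [-> c nf _]]]]; right; exists e, P, s.
have h1 w L : hform m n w L -> 0 < L.
  by move=> [e [P [s [-> _ [_ + _ _] _]]]]; case: s.
have symc u v : conjG m n u v -> conjG m n v u.
  by apply: Equivalence_Symmetric; exact: conjG_equiv.
have [[L hf]|[ef [L lL gf]]] := classify m1 n1 f.
  have [[L' hg]|[_ [L' lL' gg]]] := classify m1 n1 g.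
    (* The longer word provides the chain of tori. *)
    case/orP: (leq_total L' L) => le; first exact: H hf (gh _ _ hg) le hfc.
    by apply: symc; apply: H hg (gh _ _ hf) le (fconj_sym hfc).
  (* An elliptic g has length at most 1, and f has at least one syllable. *)
  by apply: (H _ _ _ _ hf gg _ hfc); apply: (leq_trans lL'); exact: h1 hf.
have [[L' hg]|[eg _]] := classify m1 n1 g.
  by apply: symc; apply: (H _ _ _ _ hg gf _ (fconj_sym hfc));
    apply: (leq_trans lL); exact: h1 hg.
(* Both are elliptic, and equal exponent sums give the same representative. *)
case: ef eg => [z1 [z2 cf]] [y1 [y2 cg]].
have hz e := fconj_esum e (fconj_conjG cf cg hfc).
move: (hz false) (hz true); rewrite !esum_cat !esum_wpow /= !addr0 !add0r => E1 E2.
rewrite E1 E2 in cf; have E := conjG_equiv m n.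
exact: Equivalence_Transitive _ _ _ cf (symc _ _ cg).
Qed.
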